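(* Let $\zeta_N$ be the stratified sample with parameter $a\in(0,1)$, where $N_1=\max\{[aN],1\}$ and $N_{-1}=N-N_1$; let $\psi:\{-1,1\}\to\mathbb{R}_+$ be a penalty function, $f:\mathbb{X}\to\{-1,1\}$ an arbitrary function, and let $f_{PA}$ define a prediction algorithm. Assume that for every $k=1,\dots,K$ and $y\in\{-1,1\}$ $$\widehat{\psi}(y,\zeta_N(\overline{S_k(N)}),\widehat{\mathsf P}_N)\to\psi(y)\quad\text{a.s.},\ N\to\infty,$$ and that there exists a non-empty set $U\subset\mathbb{X}$ such that for each $x\in U$ and each $k=1,\dots,K$ $$f_{PA}(x,\zeta_N(\overline{S_k(N)}),\widehat{\mathsf P}_N)\to f(x)\quad\text{a.s.},\ N\to\infty.$$ Then, for each $a\in(0,1)$, $$\widehat{Err}_K(f_{PA},\zeta_N,\widehat{\mathsf P}_N)\to Err(f)\quad\text{a.s.},\ N\to\infty,$$ if and only if $$\sum_{k=1}^K\sum_{y\in\{-1,1\}}\sum_{x\in\mathbb{X}_y} y\,\mathbb{I}\{f_{PA}(x,\zeta_N(\overline{S_k(N)}),\widehat{\mathsf P}_N)=-y\}\,L(x)\to 0\quad\text{a.s.},\ N\to\infty,$$ where $\mathbb{X}_y=(\mathbb{X}\setminus U)\cap\{x\in\mathbb{X}: f(x)=y\}$ for $y\in\{-1,1\}$, and $L(x)=\psi(1)\mathsf P(X=x,Y=1)-\psi(-1)\mathsf P(X=x,Y=-1)$ for $x\in\mathbb{X}$.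
   Context: All random elements are defined on a probability space $(\Omega,\mathcal F,\mathsf P)$. $\mathbb{X}=\mathbb{X}_1\times\dots\times\mathbb{X}_n$ is a product of finite sets, $X=(X_1,\dots,X_n)$ takes values in $\mathbb{X}$ and $Y$ takes values in $\{-1,1\}$, with $0<\mathsf P(Y=1)<1$. $(X,Y),(X^1,Y^1),(X^2,Y^2),\dots$ are i.i.d. A penalty function is a function $\psi:\{-1,1\}\to\mathbb{R}_+$, $\psi\not\equiv 0$. The error function is $Err(f)=\mathsf E|Y-f(X)|\psi(Y)=2\sum_{y\in\{-1,1\}}\psi(y)\mathsf P(Y=y,f(X)\ne y)$. (The sets $\mathbb{X}_y$, $y\in\{-1,1\}$, in the claim are defined there and are not the factors of the product.) For $y\in\{-1,1\}$ let $j_y^1<j_y^2<\dots$ be the (random) successive indices $i\ge 1$ for which $Y^i=y$ (almost surely there are infinitely many). $[\cdot]$ denotes the integer part, $\mathbb{I}$ an indicator, $\sharp$ cardinality. For fixed $a\in(0,1)$ and $N\in\mathbb{N}$ put $N_1=\max\{[aN],1\}$, $N_{-1}=N-N_1$. The stratified sample is $\zeta_N=\zeta_{N_1}^{1}\cup\zeta_{N_{-1}}^{-1}$ with $\zeta_{N_y}^{y}=\{(X^{j_y^1},y),\dots,(X^{j_y^{N_y}},y)\}$. For $S\subset\{j_1^1,\dots,j_1^{N_1}\}\cup\{j_{-1}^1,\dots,j_{-1}^{N_{-1}}\}$ put $\zeta_N(S)=\{(X^j,Y^j):j\in S\}$. $\widehat{\mathsf P}_N=(\widehat{\mathsf P}_N^{-1},\widehat{\mathsf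 P}_N^{1})$, where $\widehat{\mathsf P}_N^y$ are estimators of $\mathsf P(Y=y)$ such that $\widehat{\mathsf P}_N^y\to\mathsf P(Y=y)$ a.s. as $N\to\infty$, $y\in\{-1,1\}$ (standing assumption). A prediction algorithm is given by a function $f_{PA}$ with values in $\{-1,1\}$: $f_{PA}(x,\zeta_N(S),\widehat{\mathsf P}_N)$ is constructed from $x\in\mathbb{X}$, a subsample $\zeta_N(S)$ and $\widehat{\mathsf P}_N$ (a family of functions, one for each possible size of the subsample). Fix $K\in\mathbb{N}$. For $k=1,\dots,K$ and $y\in\{-1,1\}$ put $$S_k^y(N_y)=\Big\{j_y^i:\ i\in\Big\{(k-1)\Big[\tfrac{N_y}{K}\Big]+1,\dots,k\Big[\tfrac{N_y}{K}\Big]\mathbb{I}\{k<K\}+N_y\mathbb{I}\{k=K\}\Big\}\Big\},$$ $S_k(N)=S_k^1(N_1)\cup S_k^{-1}(N_{-1})$, and $\overline{S_k(N)}=\big(\{j_1^1,\dots,j_1^{N_1}\}\cup\{j_{-1}^1,\dots,j_{-1}^{N_{-1}}\}\big)\setminus S_k(N)$. $\widehat\psi(y,\zeta_N(\overline{S_k(N)}),\widehat{\mathsf P}_N)$ is an estimate of $\psi(y)$ constructed from $\zeta_N(\overline{S_k(N)})$ and $\widehat{\mathsf P}_N$. The estimate of the error is $$\widehat{Err}_K(f_{PA},\zeta_N,\widehat{\mathsf P}_N)=\frac{2}{K}\sum_{y\in\{-1,1\}}\sum_{k=1}^K\sum_{j\in S_k^y(N_y)}\frac{\widehat\psi(y,\zeta_N(\overline{S_k(N)}),\widehat{\mathsf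 P}_N)\,\mathbb{I}\{f_{PA}(X^j,\zeta_N(\overline{S_k(N)}),\widehat{\mathsf P}_N)\ne y\}\,\widehat{\mathsf P}_N^y}{\sharp S_k^y(N_y)},$$ which is defined for all sufficiently large $N$ (so that all $S_k^y(N_y)$ are non-empty). *)

(* Defs.v *)
From HB Require Import structures.
From mathcomp Require Import all_boot all_order all_algebra finmap.
From mathcomp Require Import all_classical all_reals all_analysis.

Set Implicit Arguments.
Unset Strict Implicit.
Unset Printing Implicit Defensive.

Import Order.TTheory GRing.Theory Num.Theory.
Import numFieldNormedType.Exports.

Local Open Scope classical_set_scope.
Local Open Scope fset_scope.
Local Open Scope ring_scope.

(* The label set {-1, 1}: [true] stands for 1, [false] for -1, so that the
   label -y is [~~ y]. *)
Definition label : finType := bool.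

Definition labR (R : realType) (y : label) : R := if y then 1 else -1.

(* The target T carries its power set as sigma-algebra; this is the intended
   structure only for countable T (below T is finite). *)
Definition discrete_rv d (Omega : measurableType d) (T : Type)
    (Z : Omega -> T) : Prop :=
  forall A : set T, measurable (Z @^-1` A).

Definition mutually_independent d (Omega : measurableType d) (R : realType)
    (P : probability Omega R) (T : Type) (Z : nat -> Omega -> T) : Prop :=
  forall (s : seq nat) (A : nat -> set T), uniq s ->
    P (\bigcap_(i in [set` s]) (Z i @^-1` A i)) =
    (\prod_(i <- s) P (Z i @^-1` A i))%E.

Definition identically_distributed d (Omega : measurableType d) (R : realType)
    (P : probability Omega R) (T : Type) (Z : nat -> Omega -> T) : Prop :=
  forall (i j : nat) (A : set T), P (Z i @^-1` A) = P (Z j @^-1` A).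

Definition iid d (Omega : measurableType d) (R : realType)
    (P : probability Omega R) (T : Type) (Z : nat -> Omega -> T) : Prop :=
  [/\ forall i, discrete_rv (Z i), mutually_independent P Z &
      identically_distributed P Z].

Definition penalty (R : realType) (psi : label -> R) : Prop :=
  (forall y, 0 <= psi y) /\ (exists y, psi y != 0).

Definition Err d (Omega : measurableType d) (R : realType)
    (P : probability Omega R) (XX : finType)
    (X : Omega -> XX) (Y : Omega -> label) (psi : label -> R)
    (f : XX -> label) : R :=
  fine ('E_P[fun w => `|labR R (Y w) - labR R (f (X w))| * psi (Y w)]).

(* N_1 = max([a N], 1) and N_{-1} = N - N_1 (the latter has its usual meaning
   as soon as 1 <= N). *)
Definition stratum_size (R : realType) (a : R) (N : nat) (y : label) : nat :=
  let N1 := maxn (Num.truncn (a * N%:R)) 1 in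
  if y then N1 else (N - N1)%N.

(* The index j_y^i (for i >= 1) along the label sequence Ys 1, Ys 2, ...:
   the j >= 1 at which y occurs for the i-th time.  The default value 0 is only
   taken if y occurs fewer than i times, which has probability 0; Ys 0 is never
   used. *)
Definition occ (Ys : nat -> label) (y : label) (i : nat) : nat :=
  xget 0%N [set j : nat | [/\ (1 <= j)%N, Ys j = y &
                           count (fun l => Ys l == y) (iota 1 j) = i]].

Definition strat_idx (R : realType) (a : R) (Ys : nat -> label) (N : nat) :
    {fset nat} :=
  [fset occ Ys true i | i in index_iota 1 (stratum_size a N true).+1] `|`
  [fset occ Ys false i | i in index_iota 1 (stratum_size a N false).+1].

(* S_k^y(m), where m plays the role of N_y; meant for 1 <= k <= K. *)
Definition fold_y (Ys : nat -> label) (K k : nat) (y : label) (m : nat) :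
    {fset nat} :=
  let lo := ((k - 1) * (m %/ K) + 1)%N in
  let hi := (k * (m %/ K) * (k < K) + m * (k == K))%N in
  [fset occ Ys y i | i in index_iota lo hi.+1].

Definition fold (R : realType) (a : R) (Ys : nat -> label) (K k N : nat) :
    {fset nat} :=
  fold_y Ys K k true (stratum_size a N true) `|`
  fold_y Ys K k false (stratum_size a N false).

Definition fold_compl (R : realType) (a : R) (Ys : nat -> label) (K k N : nat) :
    {fset nat} :=
  strat_idx a Ys N `\` fold a Ys K k N.

(* The subsample {(X^j, Y^j) : j in S} with repetitions, listed by increasing
   index j. *)
Definition subsample (XX : finType) (Xs : nat -> XX) (Ys : nat -> label)
    (S : {fset nat}) : seq (XX * label) :=
  [seq (Xs j, Ys j) | j <- sort leq S].

(* The training sample: the subsample on the complement of the k-th fold. *)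
Definition train (R : realType) (XX : finType) (a : R) (Xs : nat -> XX)
    (Ys : nat -> label) (K k N : nat) : seq (XX * label) :=
  subsample Xs Ys (fold_compl a Ys K k N).

(* A function of a sequence amounts to a family of functions, one for each
   size of the subsample.  The last argument is the value, y |-> p_y, of the
   estimator of the vector (P(Y = y))_y. *)
Definition prediction_algorithm (R : realType) (XX : finType) : Type :=
  XX -> seq (XX * label) -> (label -> R) -> label.

Definition penalty_estimator (R : realType) (XX : finType) : Type :=
  label -> seq (XX * label) -> (label -> R) -> R.

(* The estimated error, for one realization Xs, Ys of the observations and one
   value p of the estimator of (P(Y = y))_y.  It is meaningful once all the
   sets S_k^y are non-empty, that is, for all large N. *)
Definition Err_hat (R : realType) (XX : finType) (a : R) (K : nat)
    (fPA : prediction_algorithm R XX) (psihat : penalty_estimator R XX)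
    (Xs : nat -> XX) (Ys : nat -> label) (p : label -> R) (N : nat) : R :=
  2 / K%:R *
  \sum_(y : label) \sum_(1 <= k < K.+1)
    \sum_(j <- fold_y Ys K k y (stratum_size a N y))
      let z := train a Xs Ys K k N in
      psihat y z p * (fPA (Xs j) z p != y)%:R * p y /
      #|` fold_y Ys K k y (stratum_size a N y)|%:R.

Definition L_diff d (Omega : measurableType d) (R : realType)
    (P : probability Omega R) (XX : finType)
    (X : Omega -> XX) (Y : Omega -> label) (psi : label -> R) (x : XX) : R :=
  psi true * fine (P [set w | X w = x /\ Y w = true]) -
  psi false * fine (P [set w | X w = x /\ Y w = false]).

Definition off_set (XX : finType) (U : {set XX}) (f : XX -> label) (y : label) :
    {set XX} :=
  (~: U :&: [set x | f x == y])%SET.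

(* Main.v *)
(** The two convergences are equivalent for almost every single outcome.  The
   sequence sampled inside the stratum of label [y] is not analysed as a
   conditional i.i.d. sequence: by the strong law of large numbers for the
   indicators of [X^i = x, Y^i = y] and of [Y^i = y], the quotient of the two
   frequencies tends to [P(X = x | Y = y)], and reading this quotient at the
   times where the [m]-th label [y] occurs gives the frequency of [x] among the
   first [m] elements of the stratum.  A fold is the difference of two initial
   segments of the stratum, of length proportional to that of the stratum, so
   that [x] has the same limit frequency in each fold.  Hence the estimated
   error differs by a null sequence from the mean over the folds of the exact
   penalized errors of the trained predictors.  The latter error exceeds that of
   [f] only through points outside [U]; at such a point with [f x = y],
   predicting [-y] instead of [y] changes it by twice [y L(x)]. *)

Require Import Defs.
From HB Require Import structures.
From mathcomp Require Import all_boot all_order all_algebra finmap.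
From mathcomp Require Import all_classical all_reals all_analysis.
From mathcomp Require Import measurable_realfun.
From mathcomp Require Import ring lra zify.
Set Implicit Arguments.
Unset Strict Implicit.
Unset Printing Implicit Defensive.

Import Order.TTheory GRing.Theory Num.Theory.
Import numFieldNormedType.Exports.
Local Open Scope classical_set_scope.
Local Open Scope ring_scope.

(** * Expectations of finite linear combinations *)

(** Integrability and value are bundled, so that both pass together through sums and scalings. *)
Definition has_expectation d (Omega : measurableType d) (R : realType)
    (P : probability Omega R) (g : Omega -> R) (r : R) : Prop :=
  P.-integrable setT (EFin \o g) /\ (\int[P]_w (g w)%:E = r%:E)%E.

Lemma has_expectation_cst d (Omega : measurableType d) (R : realType)
    (P : probability Omega R) (r : R) : has_expectation P (fun=> r) r.
Proof.
split; first exact: (finite_measure_integrable_cst P r).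
rewrite (@integral_cst _ _ _ P _ measurableT r%:E) -[RHS]mule1.
congr (_ * _)%E; exact: probability_setT.
Qed.

Lemma has_expectation_indic d (Omega : measurableType d) (R : realType)
    (P : probability Omega R) (A : set Omega) :
  measurable A -> has_expectation P (\1_A) (fine (P A)).
Proof.
move=> mA; split; first exact: integrable_indic.
by rewrite integral_indic// setIT fineK// fin_num_measure.
Qed.

Lemma has_expectationD d (Omega : measurableType d) (R : realType)
    (P : probability Omega R) (g h : Omega -> R) (r s : R) :
  has_expectation P g r -> has_expectation P h s ->
  has_expectation P (fun w => g w + h w) (r + s).
Proof.
move=> [ig eg] [ih eh]; split.
  by have := integrableD measurableT ig ih; apply: eq_integrable => // x _.
by rewrite EFinD -eg -eh -integralD_EFin//.
Qed.

Lemma has_expectationZ d (Omega : measurableType d) (R : realType)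
    (P : probability Omega R) (c : R) (g : Omega -> R) (r : R) :
  has_expectation P g r -> has_expectation P (fun w => c * g w) (c * r).
Proof.
move=> [ig eg]; split.
  by have := integrableZl measurableT c ig; apply: eq_integrable => // x _.
by rewrite EFinM -eg -integralZl//.
Qed.

Lemma has_expectation_sum d (Omega : measurableType d) (R : realType)
    (P : probability Omega R) (I : Type) (s : seq I) (g : I -> Omega -> R)
    (r : I -> R) :
  (forall i, has_expectation P (g i) (r i)) ->
  has_expectation P (fun w => \sum_(i <- s) g i w) (\sum_(i <- s) r i).
Proof.
move=> gr; elim: s => [|i s IH].
  rewrite big_nil (_ : (fun w => _) = fun=> 0).
    exact: has_expectation_cst.
  by apply/funext => w; rewrite big_nil.
rewrite big_cons (_ : (fun w => _) = (fun w => g i w + \sum_(i <- s) g i w)).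
  exact: has_expectationD.
by apply/funext => w; rewrite big_cons.
Qed.

(** * The strong law of large numbers for frequencies of events *)

(** Expanding the square leaves the double sum of the probabilities of [A i]&[A j], in which the
    diagonal contributes [p] and every other pair [p * p]. *)
Lemma pairwise_indep_variance d (Omega : measurableType d) (R : realType)
    (P : probability Omega R) (A : nat -> set Omega) (p : R) (n : nat) :
  (forall i, measurable (A i)) -> (forall i, P (A i) = p%:E) ->
  (forall i j, i != j -> P (A i `&` A j) = (p * p)%:E) ->
  has_expectation P (fun w => (\sum_(0 <= i < n) \1_(A i) w - n%:R * p) ^+ 2)
    (n%:R * (p * (1 - p))).
Proof.
move=> mA pA indA.
pose q (i j : nat) : R := if i == j then p else p * p.
have E2 : has_expectation P
    (fun w => \sum_(0 <= i < n) \sum_(0 <= j < n) \1_(A i `&` A j) w)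
    (\sum_(0 <= i < n) \sum_(0 <= j < n) q i j).
  apply: has_expectation_sum => i; apply: has_expectation_sum => j.
  rewrite (_ : q i j = fine (P (A i `&` A j))).
    exact/has_expectation_indic/measurableI.
  rewrite /q; case: eqVneq => [->|ij]; last by rewrite indA.
  by rewrite setIid pA.
have E1 : has_expectation P (fun w => \sum_(0 <= i < n) \1_(A i) w)
    (\sum_(0 <= i < n) p).
  apply: has_expectation_sum => i.
  by have := has_expectation_indic P (mA i); rewrite pA.
have := has_expectationD (has_expectationD E2
  (has_expectationZ (- (2 * (n%:R * p))) E1))
  (has_expectation_cst P ((n%:R * p) ^+ 2)).
congr has_expectation.
  apply/funext => w; under eq_bigr do under eq_bigr do rewrite indicI /=.
  under eq_bigr do rewrite -mulr_sumr.
  by rewrite -mulr_suml; ring.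
rewrite sumr_const_nat subn0 -mulr_natl.
suff -> : \sum_(0 <= i < n) \sum_(0 <= j < n) q i j =
    n%:R * (n%:R * (p * p) + (p - p * p)) by ring.
(* Each row of the double sum is [n] copies of [p * p], corrected by [p - p * p] at its diagonal
   entry. *)
rewrite (eq_big_nat _ _ (F2 := fun=> n%:R * (p * p) + (p - p * p))); last first.
  move=> i /andP[_ ltin].
  rewrite -[n in LHS]subn0 -{1}(subn0 n).
  have -> : n%:R * (p * p) = \sum_(0 <= j < n) p * p.
    by rewrite sumr_const_nat subn0 mulr_natl.
  have -> : p - p * p = \sum_(0 <= j < n) (if j == i then p - p * p else 0).
    by rewrite -big_mkcond big_nat1_eq ltin.
  rewrite !subn0 -big_split; apply: eq_bigr => j _; rewrite /q (eq_sym i).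
  by case: ifP => _ /=; ring.
by rewrite sumr_const_nat subn0 [RHS]mulr_natl.
Qed.

(* The series of the [g k] has a finite expectation, hence converges almost
   surely, and its terms tend to 0. *)
Lemma ae_cvg0_summable_expectation d (Omega : measurableType d) (R : realType)
    (P : probability Omega R) (g : nat -> Omega -> R) (r : nat -> R) (C : R) :
  (forall k w, 0 <= g k w) -> (forall k, has_expectation P (g k) (r k)) ->
  (forall n, \sum_(0 <= k < n) r k <= C) ->
  {ae P, forall w, g k w @[k --> \oo] --> (0 : R)}.
Proof.
move=> g0 gr rC.
have mg k : measurable_fun setT (EFin \o g k : Omega -> \bar R).
  by have [/integrableP[]] := gr k.
pose G w := (\sum_(k <oo) (g k w)%:E)%E.
have G0 w : (0 <= G w)%E.
  by apply: nneseries_ge0 => k _ _; rewrite lee_fin.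
have mG : measurable_fun setT G.
  apply: (@ge0_emeasurable_sum _ _ _ setT (fun k w => (g k w)%:E) xpredT) => //.
  by move=> k w _ _; rewrite lee_fin.
  by move=> k _; exact: mg.
have iG : P.-integrable setT G.
  apply/integrableP; split; first exact: mG.
  under eq_integral do rewrite gee0_abs//.
  rewrite integral_nneseries//; last by move=> k w _; rewrite lee_fin.
  apply: (@le_lt_trans _ _ C%:E); last exact: ltry.
  apply: lime_le.
    apply: is_cvg_ereal_nneg_natsum => k _.
    by apply: integral_ge0 => w _; rewrite lee_fin.
  apply: nearW => n.
  under eq_bigr do rewrite (gr _).2.
  by rewrite sumEFin lee_fin.
have := integrable_ae measurableT iG; apply: filterS => w /(_ I) Gfin.
apply: cvg_series_cvg_0.
apply: nondecreasing_is_cvgn.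
  apply/nondecreasing_seqP => n.
  by rewrite !seriesEnat/= big_nat_recr//= lerDl.
exists (fine (G w)) => _ [n _ <-].
rewrite -lee_fin fineK// seriesEnat/= -sumEFin.
by apply: nneseries_lim_ge => k _; rewrite lee_fin.
Qed.

Lemma sum_inv_sqr_le (R : realType) (n : nat) :
  \sum_(0 <= k < n) ((k.+1 ^ 2)%:R)^-1 <= 2 :> R.
Proof.
(* The sharper bound carries the induction, since 1/(m+2)^2 is at most 1/(m+1) - 1/(m+2). *)
suff h m : \sum_(0 <= k < m.+1) ((k.+1 ^ 2)%:R)^-1 <= 2 - (m.+1%:R)^-1 :> R.
  case: n => [|n]; first by rewrite big_nil.
  by apply: le_trans (h n) _; rewrite gerBl.
elim: m => [|m IH].
  by rewrite big_nat1 exp1n (_ : 1%:R^-1 = 1) ?invr1//; lra.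
rewrite big_nat_recr//=.
apply: (@le_trans _ _ (2 - m.+1%:R^-1 + ((m.+2 ^ 2)%:R)^-1)).
  by rewrite lerD2r.
have a0 : 0 < m.+1%:R :> R by rewrite ltr0n.
have b0 : 0 < m.+2%:R :> R by rewrite ltr0n.
have ab : m.+2%:R = m.+1%:R + 1 :> R by rewrite -natr1.
suff : (m.+2%:R ^+ 2)^-1 <= m.+1%:R^-1 - m.+2%:R^-1 :> R.
  by rewrite natrX -addrA lerD2l addrC lerBlDr [X in _ -> _ <= X]addrC.
have -> : m.+1%:R^-1 - m.+2%:R^-1 = (m.+1%:R * m.+2%:R)^-1 :> R.
  rewrite ab; field.
  by rewrite !gt_eqF// -ab.
rewrite lef_pV2 ?posrE ?exprn_gt0 ?mulr_gt0// expr2 ler_pM2r//.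
by rewrite ab lerDl.
Qed.

(* [S m / m] is squeezed between its values at two consecutive squares, up to
   the ratio of these squares, which tends to 1. *)
Lemma cvg_mean_of_squares (R : realType) (S : nat -> R) (p : R) :
  S 0%N = 0 -> {homo S : m n / (m <= n)%N >-> m <= n} ->
  S (k.+1 ^ 2)%N / (k.+1 ^ 2)%:R @[k --> \oo] --> p ->
  S m / m%:R @[m --> \oo] --> p.
Proof.
move=> S0 Smono Sp.
have S_ge0 m : 0 <= S m by rewrite -S0 Smono.
(* The integer square root of [m] locates it between two consecutive squares. *)
have root m : exists k, (k ^ 2 <= m < k.+1 ^ 2)%N.
  elim: m => [|m [k /andP[km mk]]]; first by exists 0%N.
  case: (ltnP m.+1 (k.+1 ^ 2)) => h; last by exists k.+1; nia.
  by exists k; rewrite h leqW.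
have [r rP] := choice root.
have r_oo : r m @[m --> \oo] --> \oo.
  apply/cvgnyPge => A; near=> m.
  have : (A ^ 2 <= m)%N by near: m; exact: nbhs_infty_ge.
  by move: (rP m); nia.
have q1 : k.+1%:R / k.+2%:R @[k --> \oo] --> (1 : R).
  have -> : (fun k => k.+1%:R / k.+2%:R) = (fun k => 1 - k.+2%:R^-1)
      :> (nat -> R).
    apply/funext => k.
    by rewrite -[k.+1%:R](addrK 1) natr1 mulrBl divff ?pnatr_eq0// mul1r.
  rewrite -[X in _ --> X]subr0; apply: cvgB; first exact: cvg_cst.
  by have := @cvg_harmonic R; rewrite -cvg_shiftS.
have q2 : k.+2%:R / k.+1%:R @[k --> \oo] --> (1 : R).
  have -> : (fun k => k.+2%:R / k.+1%:R) = (fun k => (k.+1%:R / k.+2%:R)^-1)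
      :> (nat -> R).
    by apply/funext => k; rewrite invfM invrK mulrC.
  by rewrite -[X in _ --> X]invr1; apply: cvgV => //; exact: oner_neq0.
pose u k := S (k.+1 ^ 2)%N / (k.+1 ^ 2)%:R.
have lo : u k * (k.+1%:R / k.+2%:R * (k.+1%:R / k.+2%:R)) @[k --> \oo] --> p.
  rewrite -[X in _ --> X]mulr1 -[X in _ * X]mulr1.
  by apply: cvgM => //; apply: cvgM.
have hi : u k.+1 * (k.+2%:R / k.+1%:R * (k.+2%:R / k.+1%:R)) @[k --> \oo] --> p.
  rewrite -[X in _ --> X]mulr1 -[X in _ * X]mulr1.
  apply: cvgM; last exact: cvgM.
  by move: Sp; rewrite -cvg_shiftS.
(* The sequence [u] takes the square of [k.+1] at index [k], so the root [r m] corresponds to the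
   index [(r m).-1]. *)
have pr_oo : (r m).-1 @[m --> \oo] --> \oo.
  apply/cvgnyPge => A.
  by move/cvgnyPge : r_oo => /(_ A.+1); apply: filterS => m; lia.
apply: (@squeeze_cvgr _ _ _ _ _ _ _ _ _
    (cvg_comp _ _ pr_oo lo) (cvg_comp _ _ pr_oo hi)).
near=> m.
have rm : (1 <= r m)%N by near: m; move/cvgnyPge : r_oo; exact.
have /andP[km mk] := rP m.
rewrite /= /u; move: km mk; case: (r m) rm => // k _ km mk /=.
have m0 : (0 < m)%N by apply: leq_trans km; rewrite expn_gt0.
have frac (a b s : R) : a != 0 -> b != 0 ->
    s / a ^+ 2 * (a / b * (a / b)) = s / b ^+ 2.
  by move=> a0 b0; field; rewrite a0 b0.
have e1 : S (k.+1 ^ 2)%N / (k.+1 ^ 2)%:R *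
    (k.+1%:R / k.+2%:R * (k.+1%:R / k.+2%:R)) =
    S (k.+1 ^ 2)%N / (k.+2 ^ 2)%:R :> R.
  by rewrite !natrX frac ?pnatr_eq0.
have e2 : S (k.+2 ^ 2)%N / (k.+2 ^ 2)%:R *
    (k.+2%:R / k.+1%:R * (k.+2%:R / k.+1%:R)) =
    S (k.+2 ^ 2)%N / (k.+1 ^ 2)%:R :> R.
  by rewrite !natrX frac ?pnatr_eq0.
rewrite e1 e2; apply/andP; split.
- apply: ler_pM => //; first exact: Smono.
  by rewrite lef_pV2 ?posrE ?ltr0n ?expn_gt0// ler_nat ltnW.
- apply: ler_pM => //; first exact/Smono/ltnW.
  by rewrite lef_pV2 ?posrE ?ltr0n ?expn_gt0// ler_nat.
Unshelve. all: by end_near. Qed.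

(** At the sample size (k+1)^2 the mean square deviation of the frequency is p(1-p)/(k+1)^2, which
    is summable in k. Hence the frequencies converge almost surely along the squares, and
    monotonicity of the counts fills the gaps. *)
Lemma pairwise_indep_frequency d (Omega : measurableType d) (R : realType)
    (P : probability Omega R) (A : nat -> set Omega) (p : R) :
  (forall i, measurable (A i)) -> (forall i, P (A i) = p%:E) ->
  (forall i j, i != j -> P (A i `&` A j) = (p * p)%:E) ->
  {ae P, forall w,
    (\sum_(0 <= i < n) \1_(A i) w) / n%:R @[n --> \oo] --> p}.
Proof.
move=> mA pA indA.
pose S n w : R := \sum_(0 <= i < n) \1_(A i) w.
pose g k w :=
  ((k.+1 ^ 2)%:R ^- 2) * (S (k.+1 ^ 2)%N w - (k.+1 ^ 2)%:R * p) ^+ 2.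
have p01 : 0 <= p <= 1.
  by rewrite -!lee_fin -(pA 0%N) measure_ge0 probability_le1.
have aeg : {ae P, forall w, g k w @[k --> \oo] --> (0 : R)}.
  apply: (@ae_cvg0_summable_expectation _ _ _ _ _
    (fun k => (k.+1 ^ 2)%:R ^- 2 * ((k.+1 ^ 2)%:R * (p * (1 - p)))) 2).
  - by move=> k w; rewrite mulr_ge0 ?sqr_ge0// invr_ge0 sqr_ge0.
  - move=> k; apply: has_expectationZ; exact: pairwise_indep_variance.
  - move=> n; apply: le_trans (sum_inv_sqr_le R n); apply: ler_sum => k _.
    have k0 : (k.+1 ^ 2)%:R != 0 :> R by rewrite pnatr_eq0 expn_eq0.
    have -> : (k.+1 ^ 2)%:R ^- 2 * ((k.+1 ^ 2)%:R * (p * (1 - p))) =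
        ((k.+1 ^ 2)%:R)^-1 * (p * (1 - p)) by field.
    by rewrite ler_piMr ?invr_ge0//; nra.
move: aeg; apply: filterS => w gw.
apply: (@cvg_mean_of_squares _ (S ^~ w)).
- by rewrite /S big_nil.
- move=> m n mn; rewrite /S (big_cat_nat (leq0n m) mn)/= lerDl.
  exact: sumr_ge0.
have gE k : g k w = (S (k.+1 ^ 2)%N w / (k.+1 ^ 2)%:R - p) ^+ 2.
  have : (k.+1 ^ 2)%:R != 0 :> R by rewrite pnatr_eq0 expn_eq0.
  by rewrite /g; move: (S _ w) (_%:R) => s c c0; field.
apply/cvgrPdist_le => e e0.
have /cvgrPdist_le/(_ (e ^+ 2)) := gw.
move=> /(_ (exprn_gt0 2 e0)); apply: filterS => k.
rewrite sub0r normrN gE normrX distrC => h.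
by rewrite -(@ler_pXn2r _ 2) ?nnegrE// ltW.
Qed.

Lemma iid_frequency d (Omega : measurableType d) (R : realType)
    (P : probability Omega R) (T : Type) (Z : nat -> Omega -> T) (B : pred T) :
  iid P Z ->
  {ae P, forall w,
    (count (fun i => B (Z i w)) (iota 1 n))%:R / n%:R @[n --> \oo] -->
    fine (P (Z 0%N @^-1` [set` B]))}.
Proof.
move=> [mZ indZ idZ].
(* The observations are counted from index 1 on; index 0, which will carry (X, Y), only names the
   common probability. *)
pose A i := Z i.+1 @^-1` [set` B].
have pA i : P (A i) = (fine (P (Z 0%N @^-1` [set` B])))%:E.
  by rewrite /A (idZ i.+1 0%N) fineK// fin_num_measure//; exact: mZ.
have indA i j : i != j -> P (A i `&` A j) =
    (fine (P (Z 0%N @^-1` [set` B])) * fine (P (Z 0%N @^-1` [set` B])))%:E.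
  move=> ij; rewrite EFinM -{1}(pA i) -(pA j).
  have := indZ [:: i.+1; j.+1] (fun=> [set` B]).
  rewrite /= inE eqSS ij => /(_ isT).
  rewrite !big_cons big_nil mule1 => <-; congr (P _).
  by rewrite bigcap_seq !big_cons big_nil setIT.
have := pairwise_indep_frequency (fun i => mZ i.+1 _) pA indA.
apply: filterS => w.
suff -> : (fun n => (\sum_(0 <= i < n) \1_(A i) w) / n%:R) =
    (fun n => (count (fun i => B (Z i w)) (iota 1 n))%:R / n%:R) :> (nat -> R).
  by [].
apply/funext => n; congr (_ / _).
rewrite -sum1_count natr_sum /index_iota subn0 (iotaDl 1 0) big_map.
rewrite [RHS]big_mkcond /=; apply: eq_bigr => i _.
rewrite indicE; case: ifPn => h; first by rewrite mem_set.
by rewrite memNset //; apply/negP.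
Qed.

(** * Occurrence indices of a label *)

Lemma iota1_cat (j j' : nat) : (j <= j')%N ->
  iota 1 j' = iota 1 j ++ iota j.+1 (j' - j).
Proof. by move=> jj'; rewrite -{1}(subnKC jj') iotaD add1n. Qed.

Lemma iota1_rcons (n : nat) : iota 1 n.+1 = rcons (iota 1 n) n.+1.
Proof. by rewrite (iota1_cat (leqnSn n)) subSnn cats1. Qed.

(** The count jumps at every occurrence of [y], so two occurrences of the same rank coincide and the
    choice in [occ] is forced. *)
Lemma occ_count (Ys : nat -> label) (y : label) (j : nat) :
  (1 <= j)%N -> Ys j = y ->
  occ Ys y (count (fun l => Ys l == y) (iota 1 j)) = j.
Proof.
move=> j1 Yj.
have lt_count i i' : (i < i')%N -> Ys i' = y ->
    (count (fun l => Ys l == y) (iota 1 i) <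
     count (fun l => Ys l == y) (iota 1 i'))%N.
  move=> ii' Yi'; rewrite (iota1_cat (ltnW ii')) count_cat -addn1 leq_add2l.
  rewrite -has_count; apply/hasP; exists i'; last exact/eqP.
  by rewrite mem_iota; lia.
apply: xget_unique => // i [i1 Yi ci].
have [ij|ji|//] := ltngtP i j.
  by have := lt_count _ _ ij Yj; rewrite ci ltnn.
by have := lt_count _ _ ji Yi; rewrite ci ltnn.
Qed.

(** This exchanges counting over time for counting over ranks: a new time is appended to both lists
    exactly when it carries the label. *)
Lemma filter_label_occ (Ys : nat -> label) (y : label) (n : nat) :
  [seq l <- iota 1 n | Ys l == y] =
  [seq occ Ys y i | i <- iota 1 (count (fun l => Ys l == y) (iota 1 n))].
Proof.
elim: n => [//|n IH].
have cS : count (fun l => Ys l == y) (iota 1 n.+1) =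
    (count (fun l => Ys l == y) (iota 1 n) + (Ys n.+1 == y))%N.
  by rewrite iota1_rcons -cats1 count_cat/= addn0.
rewrite cS [in LHS]iota1_rcons filter_rcons IH.
have := @occ_count Ys y n.+1 isT; rewrite cS.
case: eqP => [Yn /(_ Yn)|_ _]; last by rewrite addn0.
by rewrite addn1 => occn; rewrite iota1_rcons map_rcons occn.
Qed.

(** The count starts at 0 and grows by at most 1 per step, so it equals [m] at the first time when
    it is at least [m]. *)
Lemma count_label_onto (Ys : nat -> label) (y : label) (m : nat) :
  (exists n, m <= count (fun l => Ys l == y) (iota 1 n))%N ->
  exists n, count (fun l => Ys l == y) (iota 1 n) = m.
Proof.
move=> ex_n; case: (ex_minnP ex_n) => -[|n] mn minn.
  by exists 0%N; move: mn; rewrite leqn0 => /eqP ->.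
exists n.+1; apply/eqP; rewrite eqn_leq mn andbT.
have : (count (fun l => Ys l == y) (iota 1 n) < m)%N.
  by rewrite ltnNge; apply/negP => /minn; rewrite ltnn.
rewrite iota1_rcons -cats1 count_cat/= addn0.
by case: (_ == _); rewrite ?addn1 ?addn0// => /ltnW.
Qed.

Lemma count_label_unbounded (R : realType) (Ys : nat -> label) (y : label)
    (q : R) (m : nat) :
  0 < q ->
  (count (fun l => Ys l == y) (iota 1 n))%:R / n%:R @[n --> \oo] --> q ->
  exists n, (m <= count (fun l => Ys l == y) (iota 1 n))%N.
Proof.
move=> q0 cq.
suff [n _ hn] : \forall n \near \oo,
    (m <= count (fun l => Ys l == y) (iota 1 n))%N.
  by exists n; exact: hn (leqnn n).
near=> n.
have n0 : (0 < n)%N by near: n; exact: nbhs_infty_gt.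
have : q / 2 < (count (fun l => Ys l == y) (iota 1 n))%:R / n%:R.
  by near: n; apply: (cvgr_gt q cq); lra.
rewrite ltr_pdivlMr ?ltr0n// => h.
have : m%:R / (q / 2) <= n%:R by near: n; exact: nbhs_infty_ger.
rewrite ler_pdivrMr ?divr_gt0// => h'.
by rewrite -(ler_nat R); lra.
Unshelve. all: by end_near. Qed.

(** Up to a time with enough occurrences, the values of [occ] form a sublist of the duplicate-free
    [iota 1 n]; unbounded counts supply such a time and exclude the default value 0. *)
Lemma occ_inj (Ys : nat -> label) (y : label) :
  (forall m, exists n, (m <= count (fun l => Ys l == y) (iota 1 n))%N) ->
  {in [pred i | (0 < i)%N] &, injective (occ Ys y)}.
Proof.
move=> unb i j; rewrite !inE => i0 j0.
have [n nm] := count_label_onto (unb (maxn i j)).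
have : uniq [seq occ Ys y i | i <- iota 1 (maxn i j)].
  by rewrite -nm -filter_label_occ filter_uniq ?iota_uniq.
move=> /uniqP -/(_ 0%N) inj eq_occ.
(* Ranks start at 1, positions in the list at 0. *)
suff : i.-1 = j.-1 by lia.
apply: inj; rewrite ?inE ?size_map ?size_iota; try lia.
rewrite !(nth_map 0%N) ?size_iota ?nth_iota; try lia.
by rewrite !add1n !prednK.
Qed.

(** * Limit frequencies in the strata and in the folds *)

(** At a time [t m] at which the count of [y] is exactly [m], the denominators [t m] of the two
    frequencies cancel. *)
Lemma cvg_stratum_frequency (R : realType) (Ys : nat -> label) (y : label)
    (b : pred nat) (q r : R) :
  0 < q ->
  (count (fun l => Ys l == y) (iota 1 n))%:R / n%:R @[n --> \oo] --> q ->
  (count (fun l => b l && (Ys l == y)) (iota 1 n))%:R / n%:R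
    @[n --> \oo] --> r ->
  (count (fun i => b (occ Ys y i)) (iota 1 m))%:R / m%:R @[m --> \oo] --> r / q.
Proof.
move=> q0 cq cr.
have [t tP] := choice (fun m =>
  count_label_onto (count_label_unbounded m q0 cq)).
have tm m : (m <= t m)%N.
  by rewrite -{1}(tP m); apply: leq_trans (count_size _ _) _; rewrite size_iota.
have t_oo : t m @[m --> \oo] --> \oo.
  apply/cvgnyPge => A; near=> m; apply: leq_trans (tm m).
  by near: m; exact: nbhs_infty_ge.
have ratio : ((count (fun l => b l && (Ys l == y)) (iota 1 n))%:R / n%:R) /
    ((count (fun l => Ys l == y) (iota 1 n))%:R / n%:R) @[n --> \oo] --> r / q.
  by apply: cvgM => //; apply: cvgV => //; rewrite gt_eqF.
apply: cvg_trans (cvg_comp _ _ t_oo ratio); apply: near_eq_cvg.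
near=> m => /=.
have m0 : (0 < m)%N by near: m; exact: nbhs_infty_gt.
have t0 : (t m)%:R != 0 :> R by rewrite pnatr_eq0; have := tm m; lia.
rewrite tP.
have -> : count (fun l => b l && (Ys l == y)) (iota 1 (t m)) =
    count (fun i => b (occ Ys y i)) (iota 1 m).
  rewrite -{2}(tP m) -(count_map (occ Ys y) b) -filter_label_occ.
  by rewrite count_filter.
have : m%:R != 0 :> R by rewrite pnatr_eq0 -lt0n.
by move: (count _ _)%:R (t m)%:R m%:R t0 => c s u s0 u0; field; rewrite u0 s0.
Unshelve. all: by end_near. Qed.

(* The deviation [G n - r n] is at most [e n + A] for every [e > 0]. *)
Lemma cvg_increment_ratio (R : realType) (G : nat -> R) (a b : nat -> nat)
    (C : nat) (r : R) :
  G n / n%:R @[n --> \oo] --> r ->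
  (b m - a m)%N @[m --> \oo] --> \oo ->
  (\forall m \near \oo, (b m <= C * (b m - a m))%N) ->
  (G (b m) - G (a m)) / (b m - a m)%:R @[m --> \oo] --> r.
Proof.
move=> Gr D_oo bC.
pose h n := G n - r * n%:R.
have h_le e : 0 < e -> exists2 A, 0 <= A & forall n, `|h n| <= e * n%:R + A.
  move=> e0; move/cvgrPdist_le : Gr => /(_ _ e0)[n0 _ n0P].
  (* The constant absorbs the finitely many deviations up to [n0]. *)
  exists (\sum_(0 <= i < n0.+1) `|h i|); first exact: sumr_ge0.
  move=> n; have [nn0|n0n] := leqP n n0.
    apply: ler_wpDl; first by rewrite mulr_ge0// ltW.
    rewrite (bigD1_seq n) ?iota_uniq ?mem_index_iota//= ?ltnS//.
    by rewrite lerDl sumr_ge0.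
  apply: ler_wpDr; first exact: sumr_ge0.
  have n_gt0 : 0 < n%:R :> R by rewrite ltr0n; lia.
  have -> : h n = - (r - G n / n%:R) * n%:R.
    by rewrite /h; field; rewrite gt_eqF.
  rewrite normrM normrN (gtr0_norm n_gt0) ler_pM2r//.
  exact/n0P/ltnW.
apply/cvgrPdist_le => e e0.
(* With [D] the length of the increment, the two deviations add up to at most e'(a m + b m) + 2A.
   Here [a m] and [b m] are at most C D, and A is eventually at most e' D, whence the total e'(2C +
   2)D. *)
pose e' := e / (2 * C%:R + 2).
have C0 : 0 < 2 * C%:R + 2 :> R by rewrite ltr_wpDl// mulr_ge0.
have e'0 : 0 < e' by rewrite divr_gt0.
have [A A0 hA] := h_le _ e'0.
near=> m.
have D1 : (0 < b m - a m)%N by near: m; move/cvgnyPge : D_oo; exact.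
have D2 : A / e' <= (b m - a m)%:R.
  near: m; have := cvg_comp _ _ D_oo (@cvgr_idn R).
  by move/cvgryPge; exact.
have bm : (b m <= C * (b m - a m))%N by near: m.
have ab : (a m <= b m)%N by lia.
move: D2 bm; set D := (b m - a m)%N in D1 *.
rewrite ler_pdivrMr// => D2 bm.
have D0 : 0 < D%:R :> R by rewrite ltr0n.
have -> : r - (G (b m) - G (a m)) / D%:R = - (h (b m) - h (a m)) / D%:R.
  have -> : G (b m) - G (a m) = h (b m) - h (a m) + r * D%:R.
    by rewrite /h /D natrB//; ring.
  by field; rewrite gt_eqF.
rewrite normrM normrN normfV (gtr0_norm D0) ler_pdivrMr//.
apply: le_trans (ler_normB _ _) _.
apply: le_trans (lerD (hA _) (hA _)) _.
have b1 : (b m)%:R <= C%:R * D%:R :> R by rewrite -natrM ler_nat.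
have a1 : (a m)%:R <= C%:R * D%:R :> R.
  by rewrite -natrM ler_nat (leq_trans ab).
have -> : e = e' * (2 * C%:R + 2) by rewrite /e' divfK// gt_eqF.
have := ler_wpM2l (ltW e'0) b1; have := ler_wpM2l (ltW e'0) a1.
move: (e' * (a m)%:R) (e' * (b m)%:R) => x z.
lra.
Unshelve. all: by end_near. Qed.

Lemma cvg_sum_seq (R : realType) (I : eqType) (s : seq I) (u : I -> nat -> R)
    (l : I -> R) :
  (forall i, i \in s -> u i n @[n --> \oo] --> l i) ->
  \sum_(i <- s) u i n @[n --> \oo] --> \sum_(i <- s) l i.
Proof.
elim: s => [_|i s IH ul].
  rewrite big_nil; under eq_fun do rewrite big_nil; exact: cvg_cst.
rewrite big_cons; under eq_fun do rewrite big_cons.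
apply: cvgD; first by apply: ul; rewrite mem_head.
by apply: IH => j js; apply: ul; rewrite inE js orbT.
Qed.

(** The boolean will be the misclassification indicator of a trained predictor, which may oscillate
    at points outside [U]; boundedness is enough to keep a null sequence null. *)
Lemma cvg0_mul_bool (R : realType) (u : nat -> R) (b : nat -> bool) :
  u n @[n --> \oo] --> (0 : R) -> u n * (b n)%:R @[n --> \oo] --> (0 : R).
Proof.
move=> /cvgrPdist_le u0; apply/cvgrPdist_le => e /u0; apply: filterS => n /=.
by case: (b n); rewrite ?mulr1// mulr0 subr0 normr0; exact: le_trans.
Qed.

Lemma cvg_stratum_size (R : realType) (a : R) (y : label) :
  0 < a < 1 -> stratum_size a N y @[N --> \oo] --> \oo.
Proof.
move=> /andP[a0 a1]; apply/cvgnyPge => A; near=> N.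
have lo : A%:R / a <= N%:R by near: N; exact: nbhs_infty_ger.
have hi : A%:R / (1 - a) <= N%:R by near: N; exact: nbhs_infty_ger.
(* This serves the case in which the maximum defining N_1 is 1, so that the other stratum has N - 1
   elements. *)
have NA : (A.+1 <= N)%N by near: N; exact: nbhs_infty_ge.
move: lo hi; rewrite !ler_pdivrMr ?subr_gt0// => lo hi.
have aN0 : 0 <= a * N%:R by rewrite mulr_ge0// ltW.
rewrite /stratum_size; case: y.
  rewrite (leq_trans _ (leq_maxl _ _))// truncn_ge_nat//.
  by rewrite mulrC.
have : ((Num.truncn (a * N%:R)) <= N - A)%N.
  rewrite -(ler_nat R) natrB; last exact: ltnW.
  have : (Num.truncn (a * N%:R))%:R <= a * N%:R by rewrite truncn_le.
  by move=> /le_trans; apply; lra.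
by move: (Num.truncn _) => t; lia.
Unshelve. all: by end_near. Qed.

Lemma cvg_fold_frequency (R : realType) (Ys : nat -> label) (K k : nat)
    (y : label) (b : pred nat) (r : R) :
  (1 <= k <= K)%N ->
  {in [pred i | (0 < i)%N] &, injective (occ Ys y)} ->
  (count (fun i => b (occ Ys y i)) (iota 1 m))%:R / m%:R @[m --> \oo] --> r ->
  (\sum_(j <- fold_y Ys K k y m) (b j)%:R) / #|` fold_y Ys K k y m|%:R
    @[m --> \oo] --> r.
Proof.
move=> /andP[k1 kK] inj freq.
(* This is one less than the first rank of the fold, which thus consists of the ranks from
   [lo m + 1] to [hi m]. *)
pose lo m := ((k - 1) * (m %/ K))%N.
pose hi m := (k * (m %/ K) * (k < K) + m * (k == K))%N.
have divK m : (K * (m %/ K) <= m < K * (m %/ K) + K)%N.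
  by rewrite {2 3}(divn_eq m K) mulnC leq_addr ltn_add2l ltn_mod; lia.
have width m : (m %/ K <= hi m - lo m)%N.
  rewrite /hi /lo; have := divK m; move: (m %/ K)%N => q.
  by have [kK'|Kk|->] := ltngtP k K; nia.
have hi_le m : (hi m <= m)%N.
  rewrite /hi; have := divK m; move: (m %/ K)%N => q.
  by have [kK'|Kk|->] := ltngtP k K; nia.
have lo_le_hi m : (lo m <= hi m)%N.
  rewrite /hi /lo; have := divK m; move: (m %/ K)%N => q.
  by have [kK'|Kk|->] := ltngtP k K; nia.
pose G n : R := (count (fun i => b (occ Ys y i)) (iota 1 n))%:R.
have idx m : index_iota (lo m + 1) (hi m).+1 = iota (lo m).+1 (hi m - lo m).
  by rewrite /index_iota addn1 subSS.
have injm m : {in index_iota (lo m + 1) (hi m).+1 &, injective (occ Ys y)}.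
  move=> i j; rewrite !mem_index_iota => /andP[i0 _] /andP[j0 _].
  by apply: inj; rewrite inE; lia.
have D_oo : (hi m - lo m)%N @[m --> \oo] --> \oo.
  apply/cvgnyPge => A.
  have /cvgnyPge/(_ A) := cvg_divnr _ (leq_trans k1 kK).
  by apply: filterS => m h; apply: leq_trans (width m).
(* Once [m %/ K] is positive, m < K (m %/ K) + K is at most 2K (m %/ K), and the fold has at least
   [m %/ K] ranks. *)
have bnd : \forall m \near \oo, (hi m <= 2 * K * (hi m - lo m))%N.
  near=> m.
  have mK : (K <= m)%N by near: m; exact: nbhs_infty_ge.
  have /andP[_ h] := divK m.
  have q1 : (0 < m %/ K)%N by rewrite divn_gt0//; lia.
  by have := width m; have := hi_le m; nia.
have := cvg_increment_ratio (G := G) freq D_oo bnd.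
suff -> : (fun m => (G (hi m) - G (lo m)) / (hi m - lo m)%:R) =
    (fun m => (\sum_(j <- fold_y Ys K k y m) (b j)%:R) /
      #|` fold_y Ys K k y m|%:R) :> (nat -> R) by [].
apply/funext => m.
rewrite /fold_y -/(lo m) -/(hi m).
rewrite big_imfset; last exact: injm.
rewrite card_in_imfset; last exact: injm.
have enumE : perm_eq (enum_finmem (mem (index_iota (lo m + 1) (hi m).+1)))
    (iota (lo m).+1 (hi m - lo m)).
  apply: uniq_perm; rewrite ?enum_finmem_uniq ?iota_uniq// => i.
  by rewrite enum_finmemE idx.
rewrite (perm_big _ enumE) (perm_size enumE) size_iota.
congr (_ / _).
rewrite /G (iota1_cat (lo_le_hi m)) count_cat natrD addrC addKr.
by rewrite -sum1_count natr_sum big_mkcond; apply: eq_bigr => i _; case: (b _).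
Unshelve. all: by end_near. Qed.


(** * Exact and estimated errors as finite sums *)

(** At a point where [f] predicts y and [g] predicts -y, the cost psi(-y) mu(x,-y) is replaced by
    psi(y) mu(x,y); the difference is y times the last factor. *)
Lemma misclassification_swap (R : realType) (XX : finType) (psi : label -> R)
    (mu : XX -> label -> R) (f g : XX -> label) (U : {set XX}) :
  {in U, f =1 g} ->
  \sum_x \sum_y psi y * mu x y * (g x != y)%:R =
  \sum_x \sum_y psi y * mu x y * (f x != y)%:R +
  \sum_(y : label) \sum_(x in off_set U f y) labR R y * (g x == ~~ y)%:R *
    (psi true * mu x true - psi false * mu x false).
Proof.
move=> fg.
under [X in _ = _ + X]eq_bigr do rewrite big_mkcond.
rewrite [X in _ = _ + X]exchange_big -big_split; apply: eq_bigr => x _ /=.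
rewrite !big_bool /= !inE.
case: (boolP (x \in U)) => xU /=.
  by rewrite (fg x xU) !addr0.
by case: (f x) (g x) => -[] /=; rewrite /labR /=; ring.
Qed.

(** Grouping the elements of a fold by their value [x] lets the fold enter only through relative
    frequencies, while the predictor is evaluated at fixed points. *)
Lemma Err_hatE (R : realType) (XX : finType) (a : R) (K : nat)
    (fPA : prediction_algorithm R XX) (psihat : penalty_estimator R XX)
    (Xs : nat -> XX) (Ys : nat -> label) (p : label -> R) (N : nat) :
  Err_hat a K fPA psihat Xs Ys p N =
  2 / K%:R * \sum_(1 <= k < K.+1) \sum_x \sum_(y : label)
    psihat y (train a Xs Ys K k N) p * p y *
    ((\sum_(j <- fold_y Ys K k y (stratum_size a N y)) (Xs j == x)%:R) /
      #|` fold_y Ys K k y (stratum_size a N y)|%:R) *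
    (fPA x (train a Xs Ys K k N) p != y)%:R.
Proof.
rewrite /Err_hat; congr (_ * _); rewrite exchange_big; apply: eq_bigr => k _ /=.
rewrite [RHS]exchange_big; apply: eq_bigr => y _ /=.
under [RHS]eq_bigr do rewrite mulr_suml mulr_sumr mulr_suml.
rewrite [RHS]exchange_big; apply: eq_bigr => j _ /=.
rewrite (bigD1 (Xs j))//= eqxx big1 ?addr0 => [|x /negbTE].
  by rewrite mul1r; ring.
by rewrite eq_sym => ->; rewrite mul0r mulr0 mul0r.
Qed.

(** The distance between two labels is 0 or 2, so the integrand is a finite combination of
    indicators of the events X = x, Y = y. *)
Lemma ErrE d (Omega : measurableType d) (R : realType) (P : probability Omega R)
    (XX : finType) (X : Omega -> XX) (Y : Omega -> label) (psi : label -> R)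
    (f : XX -> label) :
  (forall x y, measurable [set w | X w = x /\ Y w = y]) ->
  Err P X Y psi f =
  2 * \sum_x \sum_(y : label)
    psi y * fine (P [set w | X w = x /\ Y w = y]) * (f x != y)%:R.
Proof.
move=> mXY.
have [_] : has_expectation P
    (fun w => `|labR R (Y w) - labR R (f (X w))| * psi (Y w))
    (\sum_x \sum_(y : label) 2 * psi y * (f x != y)%:R *
      fine (P [set w | X w = x /\ Y w = y])).
  suff -> : (fun w => `|labR R (Y w) - labR R (f (X w))| * psi (Y w)) =
    (fun w => \sum_x \sum_(y : label) 2 * psi y * (f x != y)%:R *
      \1_[set w | X w = x /\ Y w = y] w).
    apply: has_expectation_sum => x; apply: has_expectation_sum => y.
    exact/has_expectationZ/has_expectation_indic.
  apply/funext => w.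
  rewrite (bigD1 (X w))//= [X in _ = _ + X]big1 ?addr0 => [|x Xx]; last first.
    apply: big1 => y _; rewrite indicE memNset ?mulr0//= => -[Xw _].
    by rewrite Xw eqxx in Xx.
  rewrite (bigD1 (Y w))//= [X in _ = _ + X]big1 ?addr0 => [|y Yy]; last first.
    rewrite indicE memNset ?mulr0//= => -[_ Yw].
    by rewrite Yw eqxx in Yy.
  rewrite indicE mem_set// mulr1 mulrAC; congr (_ * _).
  case: (f (X w)) (Y w) => -[]; rewrite /labR /= ?subrr ?normr0 ?mulr0//.
    by rewrite ler0_norm; lra.
  by rewrite ger0_norm; lra.
rewrite /Err expectation.unlock => /(congr1 fine) /= Eg.
apply: etrans Eg _; rewrite mulr_sumr; apply: eq_bigr => x _.
by rewrite mulr_sumr; apply: eq_bigr => y _; ring.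
Qed.

(** * Comparison of the errors along one outcome *)

(** Distinct labels are at distance 2, so values closer than 1 come from equal labels. *)
Lemma cvg_labR (R : realType) (g : nat -> label) (l : label) :
  labR R (g N) @[N --> \oo] --> labR R l -> \forall N \near \oo, g N = l.
Proof.
move=> /cvgrPdist_lt/(_ 1 ltr01); apply: filterS => N.
case: (g N) l => -[] //; rewrite /labR /=.
  by rewrite ltr0_norm; lra.
by rewrite gtr0_norm; lra.
Qed.

(** This is the deterministic core: [q] and [mu] stand for the laws of Y and of (X, Y), and all
    limits are those of a single realization. *)
Lemma Err_hat_gap (R : realType) (XX : finType) (a : R) (K : nat)
    (fPA : prediction_algorithm R XX) (psihat : penalty_estimator R XX)
    (Xs : nat -> XX) (Ys : nat -> label) (p : nat -> label -> R)
    (psi : label -> R) (f : XX -> label) (U : {set XX})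
    (q : label -> R) (mu : XX -> label -> R) :
  0 < a < 1 -> (0 < K)%N -> (forall y, 0 < q y) ->
  (forall y, p N y @[N --> \oo] --> q y) ->
  (forall y, (count (fun l => Ys l == y) (iota 1 n))%:R / n%:R
    @[n --> \oo] --> q y) ->
  (forall x y,
    (count (fun l => (Xs l == x) && (Ys l == y)) (iota 1 n))%:R / n%:R
    @[n --> \oo] --> mu x y) ->
  (forall k y, (1 <= k <= K)%N ->
    psihat y (train a Xs Ys K k N) (p N) @[N --> \oo] --> psi y) ->
  (forall x k, x \in U -> (1 <= k <= K)%N ->
    labR R (fPA x (train a Xs Ys K k N) (p N)) @[N --> \oo] --> labR R (f x)) ->
  Err_hat a K fPA psihat Xs Ys (p N) N -
  2 / K%:R * \sum_(1 <= k < K.+1) \sum_(y : label) \sum_(x in off_set U f y)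
    labR R y * (fPA x (train a Xs Ys K k N) (p N) == ~~ y)%:R *
    (psi true * mu x true - psi false * mu x false)
  @[N --> \oo] -->
  2 * \sum_x \sum_(y : label) psi y * mu x y * (f x != y)%:R.
Proof.
move=> a01 K0 q0 pq cq cmu cpsi cf.
pose z k N := train a Xs Ys K k N.
pose F k x y N : R :=
  (\sum_(j <- fold_y Ys K k y (stratum_size a N y)) (Xs j == x)%:R) /
      #|` fold_y Ys K k y (stratum_size a N y)|%:R.
have cF k x y : (1 <= k <= K)%N -> F k x y N @[N --> \oo] --> mu x y / q y.
  move=> kK.
  have inj : {in [pred i | (0 < i)%N] &, injective (occ Ys y)}.
    by apply: occ_inj => m; exact: count_label_unbounded (q0 y) (cq y).
  have freq := cvg_stratum_frequency (b := fun l => Xs l == x)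
    (q0 y) (cq y) (cmu x y).
  exact: cvg_comp (cvg_stratum_size y a01)
    (cvg_fold_frequency (b := fun l => Xs l == x) kK inj freq).
pose E := \sum_x \sum_(y : label) psi y * mu x y * (f x != y)%:R.
(* [D] is the cost of replacing the estimated weights by the exact ones while keeping the trained
   predictors. *)
pose D N := 2 / K%:R * \sum_(1 <= k < K.+1) \sum_x \sum_(y : label)
  (psihat y (z k N) (p N) * p N y * F k x y N - psi y * mu x y) *
    (fPA x (z k N) (p N) != y)%:R.
have D0 : D N @[N --> \oo] --> (0 : R).
  have -> : 0 = 2 / K%:R * \sum_(1 <= k < K.+1) \sum_(x : XX) \sum_(y : label) 0
      :> R.
    by rewrite big1 ?mulr0// => k _; rewrite big1// => x _; rewrite big1.
  apply: cvgMl_tmp; apply: cvg_sum_seq => k; rewrite mem_index_iota ltnS => kK.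
  apply: cvg_sum_seq => x _; apply: cvg_sum_seq => y _.
  apply: cvg0_mul_bool; rewrite -[X in _ --> X](subrr (psi y * mu x y)).
  apply: cvgB; last exact: cvg_cst.
  (* The estimated label probability tends to [q y] and the fold frequency to the conditional
     probability [mu x y / q y]; their product restores the joint law. *)
  have -> : psi y * mu x y = psi y * q y * (mu x y / q y).
    by field; rewrite gt_eqF.
  by apply: cvgM; [apply: cvgM; [exact: cpsi | exact: pq] | exact: cF].
(* As there are finitely many folds and points, a single threshold on [N] makes all trained
   predictors agree with [f] on [U]. *)
have fU : \forall N \near \oo, forall k, (1 <= k <= K)%N ->
    {in U, f =1 fun x => fPA x (z k N) (p N)}.
  have : \forall N \near \oo, forall i : 'I_K.+1 * XX,
      (1 <= i.1)%N -> i.2 \in U -> f i.2 = fPA i.2 (z i.1 N) (p N).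
    apply: filter_forall => -[k x] /=.
    have [k0|_] := boolP (1 <= k)%N; last by apply: nearW.
    have [xU|_] := boolP (x \in U); last by apply: nearW => N _.
    have kK : (1 <= k <= K)%N by rewrite k0 -ltnS ltn_ord.
    by have /cvg_labR := cf x k xU kK; apply: filterS.
  apply: filterS => N h k /andP[k0 kK] x xU.
  by have := h (Ordinal (kK : k < K.+1)%N, x); exact.
(* Beyond that threshold the difference of the claim equals [D N + 2 * E]; [E] is then spread over
   the [K] folds to compare fold by fold. *)
have : D N + 2 * E @[N --> \oo] --> 2 * E.
  by rewrite -[X in _ --> X]add0r; apply: cvgD; [exact: D0 | exact: cvg_cst].
apply: cvg_trans; apply: near_eq_cvg; move: fU; apply: filterS => N fU.
rewrite Err_hatE -/(F _ _ _ _).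
have K0' : K%:R != 0 :> R by rewrite pnatr_eq0 -lt0n.
have -> : 2 * E = 2 / K%:R * \sum_(1 <= k < K.+1) E.
  by rewrite sumr_const_nat subSS subn0 -[E *+ K]mulr_natl; field.
rewrite -mulrDr -mulrBr -big_split -sumrB; congr (_ * _).
apply: eq_big_nat => k; rewrite ltnS => kK /=.
have AB : \sum_x \sum_(y : label) (psihat y (z k N) (p N) * p N y * F k x y N -
      psi y * mu x y) * (fPA x (z k N) (p N) != y)%:R +
    \sum_x \sum_(y : label) psi y * mu x y * (fPA x (z k N) (p N) != y)%:R =
    \sum_x \sum_(y : label) psihat y (z k N) (p N) * p N y * F k x y N *
      (fPA x (z k N) (p N) != y)%:R.
  rewrite -big_split; apply: eq_bigr => x _; rewrite -big_split.
  by apply: eq_bigr => y _ /=; rewrite -mulrDl subrK.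
move: AB; rewrite (misclassification_swap psi mu (fU k kK)) addrA.
by move=> /esym/eqP; rewrite -subr_eq => /eqP/esym.
Unshelve. all: by end_near. Qed.

(** * Passage to almost every outcome *)

Lemma Err_hat_cvg_iff (R : realType) (d : measure_display)
  (Omega : measurableType d) (P : probability Omega R)
  (XX : finType)
  (X : Omega -> XX) (Y : Omega -> label)
  (Xs : nat -> Omega -> XX)
  (Ys : nat -> Omega -> label)
  (hY : (0 < P [set w | Y w = true] < 1)%E)
  (hiid : iid P (fun (i : nat) (w : Omega) =>
     if i == 0%N then (X w, Y w) else (Xs i w, Ys i w)))
  (Phat : nat -> label -> Omega -> R)
  (hPhat : forall y : label,
     {ae P, forall w, (fun N => Phat N y w) @ \oo -->
                      fine (P [set w' | Y w' = y])})
  (psi : label -> R)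
  (K : nat) (hK : (0 < K)%N)
  (f : XX -> label)
  (fPA : prediction_algorithm R XX)
  (psihat : penalty_estimator R XX)
  (a : R) (ha : 0 < a < 1)
  (hpsihat : forall (k : nat) (y : label), (1 <= k <= K)%N ->
     {ae P, forall w,
       (fun N => psihat y
          (train a (Xs ^~ w) (Ys ^~ w) K k N)
          (fun y' => Phat N y' w)) @ \oo --> psi y})
  (U : {set XX})
  (hfPA : forall (x : XX) (k : nat),
     x \in U -> (1 <= k <= K)%N ->
     {ae P, forall w,
       (fun N => labR R (fPA x
          (train a (Xs ^~ w) (Ys ^~ w) K k N)
          (fun y' => Phat N y' w))) @ \oo --> labR R (f x)}) :
  {ae P, forall w,
    (fun N => Err_hat a K fPA psihat (Xs ^~ w) (Ys ^~ w)
                (fun y' => Phat N y' w) N) @ \oo --> Err P X Y psi f}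
  <->
  {ae P, forall w,
    (fun N =>
       \sum_(1 <= k < K.+1) \sum_(y : label)
         \sum_(x in off_set U f y)
           labR R y *
           (fPA x
              (train a (Xs ^~ w) (Ys ^~ w) K k N)
              (fun y' => Phat N y' w) == ~~ y)%:R *
           L_diff P X Y psi x) @ \oo --> (0 : R)}.
Proof.
have [mZ _ _] := hiid.
have mXY x y : measurable [set w | X w = x /\ Y w = y].
  have := mZ 0%N [set (x, y)]; congr measurable; apply/seteqP.
  by split => w /= [-> ->].
have mY y : measurable [set w | Y w = y].
  have := mZ 0%N [set c | c.2 = y]; congr measurable; exact/seteqP.
pose q y := fine (P [set w | Y w = y]).
have q0 y : 0 < q y.
  move: hY => /andP[Yt0 Yt1]; apply: fine_gt0; apply/andP; split; last first.
    by rewrite (le_lt_trans (probability_le1 _ _))// ltry.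
  case: y => //.
  rewrite (_ : [set w | Y w = false] = ~` [set w | Y w = true]); last first.
    by apply/seteqP; split => w /=; case: (Y w).
  by rewrite probability_setC// sube_gt0.
(* Only positive indices are counted, so the branch of the family at index 0 is never met. *)
have iota_pos (b b' : pred nat) m : (forall l, (0 < l)%N -> b l = b' l) ->
    count b (iota 1 m) = count b' (iota 1 m).
  by move=> bb'; apply: eq_in_count => l; rewrite mem_iota => /andP[/bb'].
have freqY (y : label) : {ae P, forall w,
    (count (fun l => Ys l w == y) (iota 1 m))%:R / m%:R @[m --> \oo] --> q y}.
  have := iid_frequency (fun c : XX * label => c.2 == y) hiid.
  apply: filterS => w.
  rewrite (_ : fine _ = q y); last first.
    by congr (fine (P _)); apply/seteqP; split => v /= /eqP.
  apply: cvg_trans; apply: near_eq_cvg; apply: nearW => m /=.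
  by congr (_%:R / _); apply: iota_pos => l; rewrite lt0n => /negbTE ->.
have freqXY (x : XX) (y : label) : {ae P, forall w,
    (count (fun l => (Xs l w == x) && (Ys l w == y)) (iota 1 m))%:R / m%:R
      @[m --> \oo] --> fine (P [set w' | X w' = x /\ Y w' = y])}.
  have := iid_frequency (fun c : XX * label => (c.1 == x) && (c.2 == y)) hiid.
  apply: filterS => w.
  rewrite (_ : fine (P (_ @^-1` _)) = fine (P [set w' | X w' = x /\ Y w' = y]));
    last first.
    congr (fine (P _)); apply/seteqP; split => v /=.
      by move=> /andP[/eqP/= -> /eqP/= ->].
    by move=> [-> ->]; apply/andP; split; apply/eqP.
  apply: cvg_trans; apply: near_eq_cvg; apply: nearW => m /=.
  by congr (_%:R / _); apply: iota_pos => l; rewrite lt0n => /negbTE ->.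
pose S w N := \sum_(1 <= k < K.+1) \sum_(y : label) \sum_(x in off_set U f y)
  labR R y * (fPA x (train a (Xs ^~ w) (Ys ^~ w) K k N)
    (fun y' => Phat N y' w) == ~~ y)%:R * L_diff P X Y psi x.
(* All almost sure hypotheses range over finite index sets and hold together almost surely. On that
   event the limit of [gap] makes each of the two convergences imply the other, as 2/K is not 0. *)
have gap : {ae P, forall w,
    Err_hat a K fPA psihat (Xs ^~ w) (Ys ^~ w) (fun y' => Phat N y' w) N -
    2 / K%:R * S w N @[N --> \oo] --> Err P X Y psi f}.
  have aeP := @ae_filter_ringOfSetsType _ _ _ P.
  have A1 : {ae P, forall w, forall y : label,
      Phat N y w @[N --> \oo] --> q y} by exact: filter_forall.
  have A2 : {ae P, forall w, forall y : label,
    (count (fun l => Ys l w == y) (iota 1 m))%:R / m%:R @[m --> \oo] --> q y}.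
    exact: filter_forall.
  have A3 : {ae P, forall w, forall c : XX * label,
    (count (fun l => (Xs l w == c.1) && (Ys l w == c.2)) (iota 1 m))%:R / m%:R
      @[m --> \oo] --> fine (P [set w' | X w' = c.1 /\ Y w' = c.2])}.
    by apply: filter_forall => -[x y]; exact: freqXY.
  have A4 : {ae P, forall w, forall c : 'I_K.+1 * label, (1 <= c.1)%N ->
      psihat c.2 (train a (Xs ^~ w) (Ys ^~ w) K c.1 N)
        (fun y' => Phat N y' w) @[N --> \oo] --> psi c.2}.
    apply: filter_forall => -[k y] /=.
    have [k0|_] := boolP (1 <= k)%N; last by apply: nearW.
    have kK : (1 <= k <= K)%N by rewrite k0 -ltnS ltn_ord.
    by have := hpsihat k y kK; apply: filterS.
  have A5 : {ae P, forall w, forall c : 'I_K.+1 * XX, (1 <= c.1)%N ->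
      c.2 \in U -> labR R (fPA c.2 (train a (Xs ^~ w) (Ys ^~ w) K c.1 N)
        (fun y' => Phat N y' w)) @[N --> \oo] --> labR R (f c.2)}.
    apply: filter_forall => -[k x] /=.
    have [k0|_] := boolP (1 <= k)%N; last by apply: nearW.
    have [xU|_] := boolP (x \in U); last by apply: nearW => w _.
    have kK : (1 <= k <= K)%N by rewrite k0 -ltnS ltn_ord.
    by have := hfPA x k xU kK; apply: filterS.
  apply: (filterS _ (filterI (filterI (filterI A1 A2) A3) (filterI A4 A5))).
  move=> w [[[{}A1 {}A2] {}A3] [{}A4 {}A5]].
  rewrite (ErrE P psi f mXY).
  apply: (Err_hat_gap ha hK q0 A1 A2 (fun x y => A3 (x, y))).
  - move=> k y /andP[k0 kK].
    by have := A4 (Ordinal (kK : k < K.+1)%N, y); exact.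
  - move=> x k xU /andP[k0 kK].
    by have := A5 (Ordinal (kK : k < K.+1)%N, x); exact.
have c0 : 2 / K%:R != 0 :> R.
  by rewrite mulf_neq0// ?invr_eq0 pnatr_eq0// -lt0n.
split; apply: filterS2 gap => w gapw lim.
- change (S w @ \oo --> (0 : R)).
  suff -> : S w = fun N => (2 / K%:R)^-1 *
      (Err_hat a K fPA psihat (Xs ^~ w) (Ys ^~ w) (fun y' => Phat N y' w) N -
       (Err_hat a K fPA psihat (Xs ^~ w) (Ys ^~ w) (fun y' => Phat N y' w) N -
        2 / K%:R * S w N)).
    rewrite -[X in _ --> X](mulr0 (2 / K%:R)^-1) -(subrr (Err P X Y psi f)).
    by apply: cvgMl_tmp; exact: cvgB.
  by apply/funext => N; rewrite subKr mulKf.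
- suff -> : (fun N =>
      Err_hat a K fPA psihat (Xs ^~ w) (Ys ^~ w) (fun y' => Phat N y' w) N) =
      fun N =>
      Err_hat a K fPA psihat (Xs ^~ w) (Ys ^~ w) (fun y' => Phat N y' w) N -
        2 / K%:R * S w N + 2 / K%:R * S w N.
    rewrite -[X in _ --> X]addr0 -[X in _ + X](mulr0 (2 / K%:R)).
    by apply: cvgD => //; exact: cvgMl_tmp.
  by apply/funext => N; rewrite subrK.
Qed.

Theorem theorem1 (R : realType) (d : measure_display) (Omega : measurableType d)
  (P : probability Omega R)
  (n : nat) (hn : (0 < n)%N) (T : 'I_n -> finType)
  (X : Omega -> {dffun forall i : 'I_n, T i}) (Y : Omega -> label)
  (Xs : nat -> Omega -> {dffun forall i : 'I_n, T i})
  (Ys : nat -> Omega -> label)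
  (hY : (0 < P [set w | Y w = true] < 1)%E)
  (* the index 0 of the i.i.d. family is used for (X, Y) itself *)
  (hiid : iid P (fun (i : nat) (w : Omega) =>
     if i == 0%N then (X w, Y w) else (Xs i w, Ys i w)))
  (Phat : nat -> label -> {RV P >-> R})
  (hPhat : forall y : label,
     {ae P, forall w, (fun N => Phat N y w) @ \oo -->
                      fine (P [set w' | Y w' = y])})
  (psi : label -> R) (hpsi : penalty psi)
  (K : nat) (hK : (0 < K)%N)
  (f : {dffun forall i : 'I_n, T i} -> label)
  (fPA : prediction_algorithm R {dffun forall i : 'I_n, T i})
  (psihat : penalty_estimator R {dffun forall i : 'I_n, T i})
  (a : R) (ha : 0 < a < 1)
  (hpsihat : forall (k : nat) (y : label), (1 <= k <= K)%N ->
     {ae P, forall w,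
       (fun N => psihat y
          (train a (Xs ^~ w) (Ys ^~ w) K k N)
          (fun y' => Phat N y' w)) @ \oo --> psi y})
  (U : {set {dffun forall i : 'I_n, T i}}) (hU : exists x, x \in U)
  (hfPA : forall (x : {dffun forall i : 'I_n, T i}) (k : nat),
     x \in U -> (1 <= k <= K)%N ->
     {ae P, forall w,
       (fun N => labR R (fPA x
          (train a (Xs ^~ w) (Ys ^~ w) K k N)
          (fun y' => Phat N y' w))) @ \oo --> labR R (f x)}) :
  {ae P, forall w,
    (fun N => Err_hat a K fPA psihat (Xs ^~ w) (Ys ^~ w)
                (fun y' => Phat N y' w) N) @ \oo --> Err P X Y psi f}
  <->
  {ae P, forall w,
    (fun N =>
       \sum_(1 <= k < K.+1) \sum_(y : label)
         \sum_(x in off_set U f y)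
           labR R y *
           (fPA x
              (train a (Xs ^~ w) (Ys ^~ w) K k N)
              (fun y' => Phat N y' w) == ~~ y)%:R *
           L_diff P X Y psi x) @ \oo --> (0 : R)}.
Proof.
exact: (Err_hat_cvg_iff (Phat := fun N y => Phat N y)
  hY hiid hPhat hK ha hpsihat hfPA).
Qed.
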